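(* Let $K$ be a field, let $R=K[x_1,\ldots,x_n]$, and let $I$ be a nonzero monomial ideal of $R$ such that $\deg(I)\leq 2$. Then $(I^{k+1}:I)=I^k$ for all $k\geq 1$. In particular, $\operatorname{Ass}(I^k)\subseteq\operatorname{Ass}(I^{k+1})$ for all $k\geq 1$.
   Context: For a monomial ideal $I=\langle u_1,\ldots,u_t\rangle$ of $R$ with minimal monomial generators $u_1,\ldots,u_t$, set $\deg(I)=\max\{\deg(u_i)\mid 1\leq i\leq t\}$, where $\deg(x_1^{a_1}\cdots x_n^{a_n})=\sum_{i=1}^n a_i$. Thus $\deg(I)\le 2$ means that every minimal generator has degree at most $2$; the generators need not all have the same degree. For an ideal $L$ of $R$, $\operatorname{Ass}(L)$ denotes the set of associated primes of the $R$-module $R/L$. For ideals $A,B$ of $R$, $(A:B)=\{r\in R\mid rB\subseteq A\}$. *)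

(* Defs.v *)
From mathcomp Require Import all_boot all_algebra.
From mathcomp Require Import classical_sets.
From mathcomp Require Import mpoly.

Set Implicit Arguments.
Unset Strict Implicit.
Unset Printing Implicit Defensive.

Import GRing.Theory.
Local Open Scope classical_set_scope.
Local Open Scope ring_scope.

Definition ideal_gen (R : comNzRingType) (S : set R) : set R :=
  [set x | exists (m : nat) (c s : 'I_m -> R),
     (forall i, S (s i)) /\ x = \sum_(i < m) c i * s i].

Definition ideal_mul (R : comNzRingType) (A B : set R) : set R :=
  ideal_gen [set a * b | a in A & b in B].

(* A ^ 0 is the unit ideal; for an ideal A, A ^ 1 = A * R = A. *)
Definition ideal_exp (R : comNzRingType) (A : set R) (k : nat) : set R :=
  iter k (ideal_mul A) setT.

Definition colon (R : comNzRingType) (A B : set R) : set R :=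
  [set r | [set r * b | b in B] `<=` A].

(* idealr_closed already includes properness (1 \notin P). *)
Definition prime_ideal (R : comNzRingType) (P : set R) : Prop :=
  idealr_closed (mem P) /\ prime_idealr_closed (mem P).

(* The primes of the form Ann(f + L), for f + L in R / L: an element r kills
   the class f + L exactly when r * f lies in L. *)
Definition Ass (R : comNzRingType) (L : set R) : set (set R) :=
  [set P | prime_ideal P /\ exists f : R, P = [set r | L (r * f)]].

Definition monomials_ideal (K : fieldType) (n : nat) (S : set 'X_{1..n}) :
    set {mpoly K[n]} :=
  ideal_gen [set 'X_[m] | m in S].

Definition monomial_ideal (K : fieldType) (n : nat) (I : set {mpoly K[n]}) :
    Prop :=
  exists S : set 'X_{1..n}, I = monomials_ideal S.

(* The monomials with exponents in u generate I, and no proper subfamily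
   does. *)
Definition minimal_monomial_generators (K : fieldType) (n : nat)
    (I : set {mpoly K[n]}) (u : seq 'X_{1..n}) : Prop :=
  [/\ uniq u,
      I = monomials_ideal [set m | m \in u] &
      forall v : seq 'X_{1..n}, {subset v <= u} ->
        I = monomials_ideal [set m | m \in v] -> {subset u <= v}].

(* The graph of I |-> deg(I).  By Dickson's lemma every monomial ideal has
   exactly one set of minimal monomial generators, and it is finite, so d
   exists and is unique. *)
Definition has_deg (K : fieldType) (n : nat) (I : set {mpoly K[n]}) (d : nat) :
    Prop :=
  exists2 u : seq 'X_{1..n},
    minimal_monomial_generators I u & d = (\max_(m <- u) mdeg m)%N.

(* Main.v *)
(* A monomial X^m lies in I^k exactly when some sum of k generator exponents is
   at most m, so the equality of ideals reduces to the following claim: if m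
   dominates no sum of k generators, then some generator e is such that m + e
   dominates no sum of k + 1 generators.  A generator of degree at most 1 will
   do.  When all generators have degree 2 they are the edges of a graph with
   loops, and the sums of edges satisfy a simultaneous exchange property (they
   form an even jump system), proved by an alternating walk.  Let nu be the
   largest number of edges whose sum is at most m, and suppose that adding any
   edge to m raises it by 2.  Then every end of an edge is adjacent to a vertex
   missed by a maximal sum, so there is an edge xy both of whose ends are
   missed, by p and by q.  Exchanging between p, q and a sum of nu + 2 edges
   below m + x + y yields a sum of nu + 1 edges below m.  The inclusion of
   associated primes is prime avoidance applied to (I^(k+1) : I) = I^k. *)
Require Import Defs.
From mathcomp Require Import all_boot all_algebra.
From mathcomp Require Import classical_sets boolp.
From mathcomp Require Import mpoly.
From mathcomp Require Import zify.

Set Implicit Arguments.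
Unset Strict Implicit.
Unset Printing Implicit Defensive.

Import GRing.Theory.
Local Open Scope classical_set_scope.
Local Open Scope nat_scope.

(** * Exponent vectors of small degree *)

Lemma mdeg_le n (p q : 'X_{1..n}) : (p <= q)%MM -> mdeg p <= mdeg q.
Proof. by move/lem_leo/lemc_mdeg. Qed.

Lemma mnm_subU n (p : 'X_{1..n}) i : 0 < p i -> exists p', p = (p' + U_(i))%MM.
Proof.
move=> p_gt0; exists (p - U_(i))%MM; apply/mnmP => l.
by rewrite mnmDE mnmBE mnm1E; case: eqP => [<-|_]; lia.
Qed.

Lemma mdeg2P n (e : 'X_{1..n}) : mdeg e = 2 -> exists i j, e = (U_(i) + U_(j))%MM.
Proof.
move=> dege; have [i] : exists i, 0 < e i.
  apply/existsP; apply: contraPT dege => /existsPn e0.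
  by rewrite mdegE big1 // => i _; apply/eqP; rewrite -leqn0 leqNgt.
move/mnm_subU=> [e' e_def]; have : mdeg e' == 1.
  by move: dege; rewrite e_def mdegD mdeg1 addn1 => -[->].
by case/mdeg1P=> j /eqP e'_def; exists j, i; rewrite e_def e'_def.
Qed.

(** * Sums of generators and their exchange property *)

Fixpoint gen_sums n (E : set 'X_{1..n}) (k : nat) : set 'X_{1..n} :=
  if k is k'.+1 then [set (e + m)%MM | e in E & m in gen_sums E k']
  else [set 0%MM].

Definition fits n (E : set 'X_{1..n}) (k : nat) (a : 'X_{1..n}) : Prop :=
  exists2 p, gen_sums E k p & (p <= a)%MM.

(* Exchange between p and q along the step + U_(i), followed by a step
   + U_(k) or - U_(k) towards q.  Subtraction of monomials is truncated, so
   the decreased elements are given by the witnesses p' and q'. *)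
Definition exchange_at n (J : set 'X_{1..n}) (p q : 'X_{1..n}) (i : 'I_n) : Prop :=
  (exists k q', [/\ (p + U_(i))%MM k < q k, J (p + U_(i) + U_(k))%MM, J q' &
     q = (q' + U_(i) + U_(k))%MM]) \/
  (exists k p' q', [/\ q k < (p + U_(i))%MM k, J p', J q',
     (p + U_(i) = p' + U_(k))%MM & (q + U_(k) = q' + U_(i))%MM]).

Definition simultaneous_exchange n (J : set 'X_{1..n}) : Prop :=
  forall p q i, J p -> J q -> p i < q i -> exchange_at J p q i.

Section GenSums.
Variables (n : nat) (E : set 'X_{1..n}).
Implicit Types (p q a e : 'X_{1..n}).

Lemma gen_sumsS k e p : E e -> gen_sums E k p -> gen_sums E k.+1 (e + p)%MM.
Proof. by move=> Ee kp; exists e => //; exists p. Qed.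

Lemma gen_sums_split k p i : gen_sums E k.+1 p -> 0 < p i ->
  exists e p', [/\ E e, gen_sums E k p', p = (e + p')%MM & 0 < e i].
Proof.
elim: k p => [|k IHk] p [e Ee [p' kp' <-]] /=; rewrite mnmDE => pi_gt0.
  by move: kp' pi_gt0 => ->; rewrite mnm0E addn0 => ei; exists e, 0%MM.
have [ei|ei0] := ltnP 0 (e i); first by exists e, p'.
have [|e' [p'' [Ee' kp'' -> e'i]]] := IHk p' kp'; first by lia.
exists e', (e + p'')%MM; split => //; first exact: gen_sumsS.
by rewrite !addmA [(e + e')%MM]addmC.
Qed.

Lemma fits0 a : fits E 0 a.
Proof. by exists 0%MM => //; apply/mnm_lepP => l; rewrite mnm0E. Qed.

Lemma fits_le j k a : j <= k -> fits E k a -> fits E j a.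
Proof.
move=> /subnK <-; elim: (k - j) => [//|i IHi] [_ [e _ [p ip <-]] pa].
apply: IHi; exists p => //; apply/mnm_lepP => l.
by move/mnm_lepP/(_ l): pa; rewrite mnmDE; lia.
Qed.

Lemma fits_max k a : ~ fits E k a -> exists2 nu, fits E nu a & ~ fits E nu.+1 a.
Proof.
elim: k => [/(_ (fits0 a)) //|k IHk] kS_a.
by have [ka|/IHk //] := pselect (fits E k a); exists k.
Qed.

Lemma fits_addU k a i : fits E k.+1 (a + U_(i))%MM -> fits E k a.
Proof.
move=> [p kp /mnm_lepP pa]; have [pi0|] := posnP (p i); last first.
  move=> /(gen_sums_split kp)[e [p' [Ee kp' p_def ei]]]; exists p' => //.
  apply/mnm_lepP => l; move: (pa l) ei; rewrite p_def !mnmDE mnm1E.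
  by have [<-|] := eqVneq i l; lia.
apply: (fits_le (leqnSn k)); exists p => //; apply/mnm_lepP => l.
by move: (pa l); rewrite mnmDE mnm1E; have [<-|] := eqVneq i l; lia.
Qed.

Hypothesis E2 : forall e, E e -> mdeg e = 2.

Lemma mdeg_gen_sums k p : gen_sums E k p -> mdeg p = k.*2.
Proof.
elim: k p => [p ->|k IHk _ [e Ee [p kp <-]]]; first by rewrite mdeg0.
by rewrite mdegD (E2 Ee) (IHk _ kp) doubleS.
Qed.

(* An alternating walk in the difference of two edge multisets: the edge
   of [q] at [i] either ends the walk or hands the deficit of its other
   end over to the pair [(q - edge, p)]. *)
Lemma gen_sums_exchange :
  simultaneous_exchange [set p | exists k, gen_sums E k p].
Proof.
pose J p := exists k, gen_sums E k p.
suff H N : forall j k p q i, j + k <= N -> gen_sums E j p -> gen_sums E k q ->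
    p i < q i -> exchange_at J p q i.
  by move=> p q i [j jp] [k kq] piq; apply: (H (j + k) j k).
elim: N => [|N IHN] j [|k] p q i jkN jp kq piq.
- by move: kq piq => ->; rewrite mnm0E.
- by lia.
- by move: kq piq => ->; rewrite mnm0E.
have [|e [q' [Ee kq' q_def ei]]] := gen_sums_split (i := i) kq; first by lia.
have [h e_def] : exists h, e = (U_(i) + U_(h))%MM.
  have [x [y e_def]] := mdeg2P (E2 Ee); move: ei.
  rewrite e_def mnmDE !mnm1E.
  have [-> _|_] := eqVneq x i; first by exists y.
  by have [-> _|//] := eqVneq y i; exists x; rewrite addmC.
have addE p0 : J p0 -> J (p0 + U_(i) + U_(h))%MM.
  by case=> k0 kp0; exists k0.+1; rewrite -addmA -e_def addmC; apply: gen_sumsS.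
have [ph|ph] := ltnP ((p + U_(i))%MM h) (q h).
  left; exists h, q'; split => //; first by apply: addE; exists j.
    by exists k.
  by rewrite q_def e_def addmC addmA.
have q'h : q' h < p h.
  move: ph; rewrite q_def e_def !mnmDE !mnm1E eqxx /=.
  by case: (i == h) => /=; lia.
(* The walk continues from [h] with the two sums swapped; each alternative for [(q', p)] becomes the
   opposite one for [(p, q)]. *)
have [|[l]|[l]] := IHN k j q' p h _ kq' jp q'h; first by lia.
  case=> p'' [lp Jl Jp'' p_def]; right; exists l, (p'' + U_(i) + U_(h))%MM.
  exists (q' + U_(h) + U_(l))%MM; split=> //; first 1 last.
  - exact: addE.
  - by rewrite p_def; apply/mnmP => z; rewrite !mnmDE; lia.
  - by rewrite q_def e_def; apply/mnmP => z; rewrite !mnmDE; lia.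
  by move: lp; rewrite q_def e_def !mnmDE !mnm1E; lia.
case=> q'' [p'' [lp Jq'' Jp'' q''_def p''_def]].
left; exists l, q''; split=> //.
- by move: lp; rewrite q_def e_def !mnmDE !mnm1E; lia.
- have -> : (p + U_(i) + U_(l) = p'' + U_(i) + U_(h))%MM; last exact: addE.
  by apply/mnmP => z; move/mnmP/(_ z): p''_def; rewrite !mnmDE; lia.
rewrite q_def e_def; apply/mnmP => z; move/mnmP/(_ z): q''_def.
by rewrite !mnmDE; lia.
Qed.

End GenSums.

(** * An edge with both ends missed *)

Section MissedEdge.
Variables (n : nat) (J : set 'X_{1..n}) (a : 'X_{1..n}) (d : nat) (x y : 'I_n).
Implicit Types (p q r s : 'X_{1..n}).
(** In the application [J] is the set of all sums of edges, [d] is [nu.*2], and one extra unit of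
    room admits at most one more edge. *)
Hypotheses (exchJ : simultaneous_exchange J)
  (addJ : forall s, J s -> J (s + U_(x) + U_(y))%MM)
  (maxJ : forall s, J s -> (s <= a)%MM -> mdeg s <= d)
  (maxJU : forall s i, J s -> (s <= a + U_(i))%MM -> mdeg s <= d.+2).

Let maxN s : J s -> mdeg s = d.+2 -> (forall l, s l <= a l) -> False.
Proof. by move=> Js deg_s /mnm_lepP/(maxJ Js); rewrite deg_s; lia. Qed.

(** Otherwise the edge [xy] could be added to [s] below [a]; the term [x == y] asks for two units of
    room when the edge is a loop. *)
Let missed_both s : J s -> (s <= a)%MM -> mdeg s = d ->
  s x < a x -> s y + (x == y) < a y -> False.
Proof.
move=> Js /mnm_lepP sa deg_s sx sy; apply: (maxN (addJ Js)) => [|l].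
  by rewrite !mdegD !mdeg1; lia.
rewrite !mnmDE !mnm1E; have := sa l.
have [<-|xl] := eqVneq x l; last by have [<-|] := eqVneq y l; move: sy xl; lia.
by have [e|] := eqVneq y x; move: sy; rewrite ?e ?eqxx; lia.
Qed.

(** Suppose [q] left two free units at [y], with [x != y]. Exchanging [p] with [q] at [x], either
    [p] gains two units below [a], or [q] trades a unit at [x] for one elsewhere and then misses
    both ends. *)
Let missed_y_eq p q : J p -> (p <= a)%MM -> mdeg p = d -> p x < a x ->
  J q -> (q <= a)%MM -> mdeg q = d -> q y < a y -> (q y).+1 = a y.
Proof.
move=> Jp pa deg_p px Jq qa deg_q qy; apply/eqP; rewrite eqn_leq qy leqNgt.
apply/negP => qy2; have [xy|xy] := eqVneq x y.
  by apply: (missed_both Jq) => //; rewrite xy ?eqxx; lia.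
have qx : q x = a x.
  apply/eqP; rewrite eqn_leq (mnm_lepP qa) leqNgt; apply/negP => qx.
  by apply: (missed_both Jq) => //; rewrite (negPf xy) addn0.
have pxq : p x < q x by rewrite qx.
move/mnm_lepP: (pa) => pa'; move/mnm_lepP: (qa) => qa'.
case: (exchJ Jp Jq pxq) => [[k [q' [pk Jpk _ _]]]|[k [p' [q' [pk _ Jq' _ q_def]]]]].
  apply: (maxN Jpk) => [|l]; first by rewrite !mdegD !mdeg1; lia.
  have := pa' l; move: pk px; rewrite !mnmDE !mnm1E.
  have := qa' l; have [<-|] := eqVneq k l; first by lia.
  by have [<-|] := eqVneq x l; lia.
have deg_q' : mdeg q' = d.
  by move/(congr1 (@mdeg n)): q_def; rewrite !mdegD !mdeg1; lia.
have q'E l : q l + (k == l) = q' l + (x == l).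
  by move/mnmP/(_ l): q_def; rewrite !mnmDE !mnm1E.
apply: (missed_both Jq' _ deg_q').
- apply/mnm_lepP => l; have := q'E l; have := qa' l; have := pa' l.
  move: pk; rewrite mnmDE mnm1E; have [<-|] := eqVneq k l; last by lia.
  by have [<-|] := eqVneq x k; lia.
- move: (q'E x) pk; rewrite eqxx mnmDE mnm1E.
  by have [->|] := eqVneq k x; rewrite ?eqxx; lia.
by move: (q'E y) qy2; rewrite (negPf xy); case: (k == y); lia.
Qed.

(* The edge [x y] cannot raise the bound [d] by two edges when both of its
   ends are missed by maximal elements.  This plays the role of the factor
   criticality of the components in the Gallai-Edmonds decomposition. *)
Lemma missed_edge_ge p q r : J p -> (p <= a)%MM -> mdeg p = d -> p x < a x ->
  J q -> (q <= a)%MM -> mdeg q = d -> q y < a y ->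
  J r -> (r <= a + U_(x) + U_(y))%MM -> mdeg r <> d.+4.
Proof.
move=> Jp pa deg_p px Jq qa deg_q qy Jr ra deg_r.
move/mnm_lepP: (pa) => pa'; move/mnm_lepP: (ra) => ra'.
(* The degree of [r] is too large for it to use only one of the two extra units. *)
have rx : a x + (x == y) < r x.
  rewrite ltnNge; apply/negP => rx.
  suff /(maxJU Jr) : (r <= a + U_(y))%MM by lia.
  apply/mnm_lepP => l; have := ra' l; rewrite !mnmDE !mnm1E.
  by have [<-|] := eqVneq x l; move: rx; have := eq_sym x y; lia.
have ry : a y + (x == y) < r y.
  rewrite ltnNge; apply/negP => ry.
  suff /(maxJU Jr) : (r <= a + U_(x))%MM by lia.
  apply/mnm_lepP => l; have := ra' l; rewrite !mnmDE !mnm1E.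
  by have [<-|] := eqVneq y l; move: ry; lia.
(* Pick q closest to r among the maximal elements that miss y. *)
have [N qrN] : exists N, mdeg (q - r) < N by exists (mdeg (q - r)).+1.
elim: N q Jq qa deg_q qy qrN => [//|N IHN] q Jq qa deg_q qy qrN.
have qyS := missed_y_eq Jp pa deg_p px Jq qa deg_q qy.
move/mnm_lepP: (qa) => qa'.
have qx : q x + (x == y) = a x.
  have [xy|xy] := eqVneq x y; first by rewrite xy addn1.
  apply/eqP; rewrite addn0 eqn_leq qa' leqNgt; apply/negP => qx.
  by apply: (missed_both Jq) => //; rewrite (negPf xy) addn0.
(* The left side has degree [d.+3], one less than [r]. At [x] and [y] it already reaches the bound
   on [r], so [k] is neither. *)
have [k rk] : exists k, (q + U_(x) + U_(y) + U_(y))%MM k < r k.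
  apply/existsP; apply: contraT => /existsPn rq.
  suff /mdeg_le : (r <= q + U_(x) + U_(y) + U_(y))%MM.
    by rewrite !mdegD !mdeg1; lia.
  by apply/mnm_lepP => l; rewrite leqNgt rq.
move: rk; rewrite !mnmDE !mnm1E => rk.
have kx : x != k.
  apply/negP => /eqP kx; have := ra' x; move: rk; rewrite -kx !mnmDE !mnm1E.
  by have := eq_sym x y; rewrite eqxx; lia.
have ky : y != k.
  apply/negP => /eqP ky; have := ra' y; move: rk; rewrite -ky !mnmDE !mnm1E.
  by rewrite eqxx; lia.
move: rk; rewrite (negPf kx) (negPf ky) !addn0 => qrk.
have rak : r k <= a k.
  by have := ra' k; rewrite !mnmDE !mnm1E (negPf kx) (negPf ky) !addn0.
(* A step down at [l] gives a [q'] closer to [r] that still misses [y]. A step up gives degree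
   [d.+2], so the result must exceed [a]; this can happen only at [x], with [l = x] and [x != y]. *)
case: (exchJ Jq Jr qrk) => [[l [_ [ql Jql _ _]]]|[l [q' [_ [ql Jq' _ q_def _]]]]];
  last first.
  have deg_q' : mdeg q' = d.
    by move/(congr1 (@mdeg n)): q_def; rewrite !mdegD !mdeg1; lia.
  have q'E z : q z + (k == z) = q' z + (l == z).
    by move/mnmP/(_ z): q_def; rewrite !mnmDE !mnm1E.
  have kl : k != l.
    apply/negP => /eqP kl; move: ql; rewrite -kl mnmDE mnm1E eqxx.
    by lia.
  move: ql; rewrite mnmDE mnm1E (negPf kl) addn0 => ql.
  have yl : y != l.
    by apply/negP => /eqP yl; move: ql; rewrite -yl; lia.
  apply: (IHN q') => //.
  - apply/mnm_lepP => z; have := q'E z; have := qa' z; move: qrk rak; clear.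
    by have [<-|] := eqVneq k z; lia.
  - have := q'E y; rewrite eq_sym (negPf ky) eq_sym (negPf yl).
    by move: qy; clear; lia.
  suff : mdeg (q - r) = (mdeg (q' - r)).+1 by lia.
  suff -> : (q - r = q' - r + U_(l))%MM by rewrite mdegD mdeg1 addn1.
  apply/mnmP => z; rewrite !mnmDE !mnmBE mnm1E; have := q'E z.
  move: qrk ql kl; clear; rewrite eq_sym => + + /negPf kl.
  have [<-|] := eqVneq k z; first by rewrite kl; lia.
  by have [<-|] := eqVneq l z; lia.
have deg_ql : mdeg (q + U_(k) + U_(l)) = d.+2.
  by rewrite !mdegD !mdeg1; lia.
have qa1 z : z != x -> (q + U_(k) + U_(l))%MM z <= a z.
  move=> zx; have := qa' z; have := ra' z; move: ql qrk qyS ky rak.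
  rewrite !mnmDE !mnm1E (eq_sym x z) (negPf zx) addn0; clear.
  have [<-|] := eqVneq l z; last by have [<-|] := eqVneq k z; lia.
  by have [<-|] := eqVneq y l; rewrite ?[k == y]eq_sym; lia.
have [xl|xl] := eqVneq l x; last first.
  apply: (maxN Jql deg_ql) => z.
  have [->|] := eqVneq z x; last exact: qa1.
  by rewrite !mnmDE !mnm1E eq_sym (negPf kx) (negPf xl) !addn0 qa'.
rewrite {}xl in ql Jql deg_ql qa1.
have [xy|xy] := eqVneq x y.
  apply: (maxN Jql deg_ql) => z; have [->|] := eqVneq z x; last exact: qa1.
  by rewrite !mnmDE !mnm1E eq_sym (negPf kx) eqxx -qx xy eqxx; lia.
move: qx; rewrite (negPf xy) addn0 => qx.
have pq1 : p x < (q + U_(k) + U_(x))%MM x.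
  by rewrite !mnmDE mnm1E; lia.
(* Here [q + U_(k) + U_(x)] exceeds [a] at [x] only, by one unit. The exchange with [p] yields an
   element of degree [d.+2] below [a], unless the step up is at [z = x]; then [q + U_(k) - U_(x)]
   misses both ends. *)
case: (exchJ Jp Jql pq1)
  => [[z [q' [pz Jpz Jq' q'_def]]]|[z [_ [q' [zp _ Jq' _ q'_def]]]]].
  have [zx|zx] := eqVneq z x; last first.
    apply: (maxN Jpz) => [|w]; first by rewrite !mdegD !mdeg1; lia.
    have := pa' w; have := qa1 z zx; move: pz px; rewrite !mnmDE !mnm1E.
    clear; have [<-|] := eqVneq z w; first by lia.
    by have [<-|] := eqVneq x w; lia.
  have q'E w : q w + (k == w) = q' w + (x == w).
    by move/mnmP/(_ w): q'_def; rewrite zx !mnmDE !mnm1E; lia.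
  apply: (missed_both Jq').
  - apply/mnm_lepP => w; have := q'E w; have := qa' w.
    by move: qrk rak; clear; have [<-|] := eqVneq k w; lia.
  - by move/(congr1 (@mdeg n)): q'_def; rewrite !mdegD !mdeg1; lia.
  - by have := q'E x; rewrite eqxx eq_sym (negPf kx); lia.
  by have := q'E y; rewrite eq_sym (negPf ky) (negPf xy); lia.
apply: (maxN Jq') => [|w].
  by move/(congr1 (@mdeg n)): q'_def; rewrite !mdegD !mdeg1; lia.
have : (q + U_(k) + U_(z) = q')%MM.
  by apply/mnmP => v; move/mnmP/(_ v): q'_def; rewrite !mnmDE; lia.
move=> <-; have zx : z != x.
  apply/negP => /eqP zx; move: zp; rewrite zx !mnmDE !mnm1E eqxx.
  by lia.
have := qa1 w; have := pa' w; move: zp; rewrite !mnmDE !mnm1E.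
move: zx kx qx; rewrite eq_sym [x == k]eq_sym; clear => /negPf zx /negPf kx qx.
have [<-|] := eqVneq z w; first by rewrite zx; lia.
by have [->|] := eqVneq w x; rewrite ?kx ?qx; lia.
Qed.

End MissedEdge.

(** * The colon property for exponents *)

(** The larger sum must use the extra unit at [x], so it has an edge there; deleting this edge frees
    a unit at its other end. *)
Lemma fits_maximal_missing n (E : set 'X_{1..n}) (a : 'X_{1..n}) nu x :
  (forall e, E e -> mdeg e = 2) ->
  fits E nu.+1 (a + U_(x))%MM -> ~ fits E nu.+1 a ->
  exists y p, [/\ E (U_(x) + U_(y))%MM, gen_sums E nu p, (p <= a)%MM & p y < a y].
Proof.
move=> E2 [r nu_r /mnm_lepP ra] nu_a; have [rx|rx] := leqP (r x) (a x).
  case: nu_a; exists r => //; apply/mnm_lepP => l; move: (ra l).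
  by rewrite mnmDE mnm1E; have [<-|] := eqVneq x l; lia.
have [|e [p [Ee nu_p r_def ex]]] := gen_sums_split (i := x) nu_r; first by lia.
have [y e_def] : exists y, e = (U_(x) + U_(y))%MM.
  have [z [y e_def]] := mdeg2P (E2 e Ee); move: ex.
  rewrite e_def mnmDE !mnm1E.
  have [-> _|_] := eqVneq z x; first by exists y.
  by have [-> _|//] := eqVneq y x; exists z; rewrite addmC.
exists y, p; rewrite -e_def; split=> //.
  apply/mnm_lepP => l; move: (ra l); rewrite r_def e_def !mnmDE !mnm1E.
  by lia.
by move: (ra y); rewrite r_def e_def !mnmDE !mnm1E eqxx; lia.
Qed.

Lemma fits_quadratic n (E : set 'X_{1..n}) (a : 'X_{1..n}) k :
  (forall e, E e -> mdeg e = 2) -> E !=set0 ->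
  (forall e, E e -> fits E k.+1 (a + e)%MM) -> fits E k a.
Proof.
move=> E2 [e0 Ee0] ka; apply: contrapT => kNa.
have [nu [p0 nu_p0 p0a] nuNa] := fits_max kNa.
have nu_lt_k : nu < k.
  by rewrite ltnNge; apply/negP => /fits_le kle; apply: kNa; apply: kle; exists p0.
have fitsE e : E e -> fits E nu.+2 (a + e)%MM.
  by move=> /ka; apply: fits_le.
pose J := [set p | exists j, gen_sums E j p].
have exchJ : simultaneous_exchange J by apply: gen_sums_exchange.
have maxJ s : J s -> (s <= a)%MM -> mdeg s <= nu.*2.
  move=> [j js] sa; rewrite (mdeg_gen_sums E2 js) leq_double leqNgt.
  by apply/negP => /fits_le jle; apply: nuNa; apply: jle; exists s.
have maxJU s i : J s -> (s <= a + U_(i))%MM -> mdeg s <= nu.*2.+2.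
  move=> [j js] sa; rewrite (mdeg_gen_sums E2 js) -doubleS leq_double leqNgt.
  apply/negP => /fits_le jle; apply: nuNa; apply: (@fits_addU _ _ _ _ i).
  by apply: jle; exists s.
have missing x y : E (U_(x) + U_(y))%MM ->
    exists z p, [/\ E (U_(x) + U_(z))%MM, gen_sums E nu p, (p <= a)%MM & p z < a z].
  move=> Exy; apply: fits_maximal_missing => //.
  by apply: (@fits_addU _ _ _ _ y); rewrite -addmA; apply: fitsE.
have [x [y e0_def]] := mdeg2P (E2 _ Ee0).
(* Two successive edges: [z] is missed by [p], and its neighbour [w] by [q]. *)
have [|z [p [Exz nu_p pa pz]]] := missing x y; first by rewrite -e0_def.
have [|w [q [Ezw nu_q qa qw]]] := missing z x; first by rewrite addmC.
have [r nu_r ra] := fitsE _ Ezw.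
apply: (@missed_edge_ge _ J a nu.*2 z w exchJ _ maxJ maxJU p q r) => //.
- move=> s [j js]; exists j.+1; rewrite -addmA addmC; exact: gen_sumsS.
- by exists nu.
- exact: (mdeg_gen_sums E2).
- by exists nu.
- exact: (mdeg_gen_sums E2).
- by exists nu.+2.
- by rewrite -addmA.
by rewrite (mdeg_gen_sums E2 nu_r) !doubleS.
Qed.

Lemma fits_colon n (E : set 'X_{1..n}) (a : 'X_{1..n}) k :
  (forall e, E e -> mdeg e <= 2) -> E !=set0 ->
  (forall e, E e -> fits E k.+1 (a + e)%MM) -> fits E k a.
Proof.
move=> E_le2 En0 ka.
have [[e [Ee e_le1]]|E_ge2] := pselect (exists e, E e /\ mdeg e <= 1); last first.
  apply: fits_quadratic => // e Ee; apply/eqP; rewrite eqn_leq E_le2 // ltnNge.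
  by apply/negP => e1; apply: E_ge2; exists e.
move: (ka e Ee); move: e_le1; rewrite leq_eqVlt ltnS leqn0.
move=> /orP[/mdeg1P[i /eqP ->]|]; first exact: fits_addU.
by rewrite mdeg_eq0 => /eqP ->; rewrite addm0; apply: fits_le.
Qed.

Local Open Scope ring_scope.

(** * Ideals and their powers *)

Definition ideal_closed (R : comNzRingType) (A : set R) : Prop :=
  [/\ A 0, forall x y, A x -> A y -> A (x + y) & forall c x, A x -> A (c * x)].

Section Ideals.
Variable R : comNzRingType.
Implicit Types (A B S : set R).

Lemma ideal_closed_gen S : ideal_closed (ideal_gen S).
Proof.
split.
- by exists 0%N, (fun=> 0), (fun=> 0); split; [case | rewrite big_ord0].
- move=> _ _ [m [c [s [Ss ->]]]] [m' [c' [s' [Ss' ->]]]].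
  pose glue (f : 'I_m -> R) (f' : 'I_m' -> R) i :=
    match split i with inl j => f j | inr j => f' j end.
  exists (m + m')%N, (glue c c'), (glue s s'); split.
    by move=> i; rewrite /glue; case: split.
  rewrite big_split_ord; congr (_ + _); apply: eq_bigr => i _.
    by rewrite /glue (unsplitK (inl i)).
  by rewrite /glue (unsplitK (inr i)).
move=> c _ [m [c' [s [Ss ->]]]]; exists m, (fun i => c * c' i), s; split=> //.
by rewrite mulr_sumr; apply: eq_bigr => i _; rewrite mulrA.
Qed.

Lemma sub_ideal_gen S : S `<=` ideal_gen S.
Proof.
move=> x Sx; exists 1%N, (fun=> 1), (fun=> x); split=> //.
by rewrite big_ord1 mul1r.
Qed.

Lemma ideal_gen_min S A : ideal_closed A -> S `<=` A -> ideal_gen S `<=` A.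
Proof.
move=> [A0 AD AM] SA _ [m [c [s [Ss ->]]]]; apply: big_ind => // i _.
by apply: AM; apply: SA.
Qed.

Lemma ideal_closed_mull A b : ideal_closed A -> ideal_closed [set x | A (x * b)].
Proof.
case=> A0 AD AM; split=> [|x y|c x] /=; first by rewrite mul0r.
- by rewrite mulrDl; apply: AD.
by rewrite -mulrA; apply: AM.
Qed.

Lemma ideal_mul_gen S T :
  ideal_mul (ideal_gen S) (ideal_gen T) = ideal_gen [set s * t | s in S & t in T].
Proof.
apply/seteqP; split; apply: ideal_gen_min; try exact: ideal_closed_gen; last first.
  move=> _ [s Ss [t Tt <-]]; apply: sub_ideal_gen.
  by exists s; [exact: sub_ideal_gen|exists t => //; exact: sub_ideal_gen].
have cl := ideal_closed_gen [set s * t | s in S & t in T].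
move=> _ [a Sa [b Tb <-]]; move: a Sa.
apply: (ideal_gen_min (ideal_closed_mull b cl)) => s Ss /=; rewrite mulrC.
move: b Tb; apply: (ideal_gen_min (ideal_closed_mull s cl)) => t Tt /=.
by apply: sub_ideal_gen; exists s => //; exists t => //; rewrite mulrC.
Qed.

Lemma ideal_closed_exp A k : ideal_closed (ideal_exp A k).
Proof. by case: k => [|k]; [split|exact: ideal_closed_gen]. Qed.

End Ideals.

(** * Monomial ideals and their powers *)

Section MonomialIdeals.
Variables (K : fieldType) (n : nat).
Implicit Types (S : set 'X_{1..n}) (f : {mpoly K[n]}).

(** The support condition defines an ideal, since monomials of a product are products of monomials
    of the factors. Conversely, it makes each term of [f] a multiple of a generator. *)
Lemma monomials_idealP S f :
  monomials_ideal S f <-> forall m, m \in msupp f -> exists2 s, S s & (s <= m)%MM.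
Proof.
split.
  move: f; apply: ideal_gen_min.
    split=> [m|f g fS gS m|c f fS m].
    - by rewrite msupp0.
    - by move/msuppD_le; rewrite mem_cat => /orP[/fS|/gS].
    move/msuppM_le => /allpairsP[[m1 m2] /= [_ /fS[s Ss sm2] ->]].
    by exists s => //; apply: lepm_trans sm2 (lem_addl _ _).
  move=> _ [s Ss <-] m; rewrite msuppX inE => /eqP ->.
  by exists s => //; apply: lepm_refl.
have [S0 SD SM] := ideal_closed_gen [set 'X_[K, m] | m in S].
move=> fS; rewrite [f]mpolyE big_seq; apply: big_ind => // m /fS[s Ss sm].
have -> : m = (m - s + s)%MM by rewrite submK.
rewrite mpolyXD -mul_mpolyC mulrA; apply: SM.
by apply: sub_ideal_gen; exists s.
Qed.

Lemma ideal_exp_monomials S k :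
  ideal_exp (monomials_ideal (K := K) S) k = monomials_ideal (gen_sums S k).
Proof.
elim: k => [|k IHk].
  apply/seteqP; split=> // f _; apply/monomials_idealP => m _.
  exact: fits0.
rewrite /ideal_exp iterS -/(ideal_exp _ k) IHk /monomials_ideal ideal_mul_gen.
congr ideal_gen; apply/seteqP; split.
  move=> _ [_ [e Se <-] [_ [p kp <-] <-]]; exists (e + p)%MM; last exact: mpolyXD.
  exact: gen_sumsS.
move=> _ [_ [e Se [p kp <-]] <-]; exists 'X_[e]; first by exists e.
by exists 'X_[p]; [exists p | rewrite -mpolyXD].
Qed.

Lemma ideal_exp_fitsP S k f :
  ideal_exp (monomials_ideal S) k f <-> forall m, m \in msupp f -> fits S k m.
Proof. by rewrite ideal_exp_monomials; apply: monomials_idealP. Qed.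

Lemma colon_ideal_exp S k : S !=set0 -> (forall s, S s -> (mdeg s <= 2)%N) ->
  colon (ideal_exp (monomials_ideal (K := K) S) k.+1) (monomials_ideal S) =
    ideal_exp (monomials_ideal S) k.
Proof.
move=> Sn0 S_le2; apply/seteqP; split=> f; last first.
  move=> kf _ [b Sb <-]; rewrite mulrC; apply: sub_ideal_gen.
  by exists b => //; exists f.
move=> fS; apply/ideal_exp_fitsP => m fm; apply: fits_colon => // e Se.
(* Multiplication by ['X_[e]] only shifts the support by [e]. *)
have /ideal_exp_fitsP : ideal_exp (monomials_ideal (K := K) S) k.+1 (f * 'X_[e]).
  by apply: fS; exists 'X_[e] => //; apply: sub_ideal_gen; exists e.
by apply; rewrite mcoeff_msupp addmC mcoeffMX -mcoeff_msupp.
Qed.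

End MonomialIdeals.

(* [(A^(k+1) : A) = A^k] writes the prime [(A^k : f)] as the finite
   intersection of the ideals [(A^(k+1) : f g)], [g] in [gs], so it is one of
   them. *)
Lemma Ass_subset_exp (R : comNzRingType) (gs : seq R) (k : nat) :
  let A := ideal_gen [set g | g \in gs] in
  colon (ideal_exp A k.+1) A = ideal_exp A k ->
  Ass (ideal_exp A k) `<=` Ass (ideal_exp A k.+1).
Proof.
move=> A colonA P [primeP [f P_def]]; split=> //; apply: contrapT => notAss.
have [_ _ powM] := ideal_closed_exp A k.+1.
have [[_ P1 _] PM] := primeP.
(* Without such an [r], [P] would be the annihilator of [f * g] modulo [A^(k+1)]. *)
have witness g : g \in gs -> exists2 r, ~ P r & ideal_exp A k.+1 (r * (f * g)).
  move=> gs_g; apply: contrapT => noW; apply: notAss; exists (f * g).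
  apply/seteqP; split=> r /= Pr; last first.
    by apply: contrapT => nPr; apply: noW; exists r.
  have : colon (ideal_exp A k.+1) A (r * f) by rewrite colonA; rewrite P_def in Pr.
  by rewrite mulrA; apply; exists g => //; apply: sub_ideal_gen.
have [r nPr rA] : exists2 r, ~ P r &
    forall g, g \in gs -> ideal_exp A k.+1 (r * (f * g)).
  suff H (l : seq R) : {subset l <= gs} -> exists2 r, ~ P r &
      forall g, g \in l -> ideal_exp A k.+1 (r * (f * g)) by apply: H.
  elim: l => [_|g l IHl lgs]; first by exists 1 => //; move: P1; rewrite notin_setE.
  have [|r nPr rl] := IHl; first by move=> h hl; apply: lgs; rewrite inE hl orbT.
  have [|t nPt tg] := witness g; first by apply: lgs; rewrite mem_head.
  (* Primality keeps the product of the witnesses outside [P]. *)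
  exists (t * r) => [Ptr|h].
    by have := PM t r; rewrite !in_setE => /(_ Ptr)/orP[]; rewrite in_setE.
  rewrite inE => /orP[/eqP ->|hl]; last by rewrite -mulrA; apply/powM/rl.
  by rewrite [t * r]mulrC -mulrA; apply: powM.
(* Now [r * f] multiplies every generator into [A^(k+1)], so it lies in the colon ideal [A^k], which
   puts [r] in [P]. *)
apply: nPr; rewrite P_def /= -colonA => _ [b Ab <-].
have := ideal_closed_mull (r * f) (ideal_closed_exp A k.+1).
move/ideal_gen_min; rewrite [_ * b]mulrC => /(_ [set g | g \in gs]); apply=> //.
by move=> g /= gs_g; rewrite mulrC -mulrA; apply: rA.
Qed.

Theorem theorem2p12 (K : fieldType) (n : nat) (I : set {mpoly K[n]}) (d : nat)
  (I_monomial : monomial_ideal I) (I_nonzero : I <> [set 0])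
  (I_deg : has_deg I d) (d_le2 : (d <= 2)%N) :
  (forall k : nat, (1 <= k)%N ->
     colon (ideal_exp I k.+1) I = ideal_exp I k) /\
  (forall k : nat, (1 <= k)%N ->
     Ass (ideal_exp I k) `<=` Ass (ideal_exp I k.+1)).
Proof.
have [u [_ I_def _] d_def] := I_deg.
have u_le2 m : m \in u -> (mdeg m <= 2)%N.
  by move=> um; apply: leq_trans d_le2; rewrite d_def; apply: leq_bigmax_seq.
have u_n0 : [set m | m \in u] !=set0.
  (* With no generator, every support is empty and the ideal is zero. *)
  case: u I_def {d_def u_le2} => [I_def|m u _]; last by exists m; rewrite /= mem_head.
  case: I_nonzero; apply/seteqP; split=> f /=; rewrite I_def.
    move=> /monomials_idealP f0; apply: msuppnil0.
    by case: (msupp f) f0 => [//|m s] /(_ m (mem_head _ _)) [].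
  by move=> ->; apply/monomials_idealP => m; rewrite msupp0.
have colonI k : colon (ideal_exp I k.+1) I = ideal_exp I k.
  by rewrite I_def; apply: colon_ideal_exp.
split=> k _ //.
have I_gen : I = ideal_gen [set g | g \in [seq 'X_[K, m] | m <- u]].
  rewrite I_def; congr ideal_gen; apply/seteqP; split=> g /=.
    by move=> [m um <-]; apply: map_f.
  by move=> /mapP[m um ->]; exists m.
by rewrite I_gen; apply: Ass_subset_exp; rewrite -I_gen.
Qed.
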